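(* Let $K_1,\dots,K_n\in\mathcal F_0^+$ and $\mathbf K=(K_1,\dots,K_n)$. (i) For $p\ge0$, $$as_p(K_1,\dots,K_n)=\inf_{L\in\mathcal S_0}\Big\{nV_p(\mathbf K;L^\circ,\dots,L^\circ)^{\frac{n}{n+p}}|L|^{\frac{p}{n+p}}\Big\}.$$ (ii) For $p<0$, $p\ne-n$, $$as_p(K_1,\dots,K_n)=\sup_{L\in\mathcal S_0}\Big\{nV_p(\mathbf K;L^\circ,\dots,L^\circ)^{\frac{n}{n+p}}|L|^{\frac{p}{n+p}}\Big\}.$$
   Context: Notation in $\mathbb R^n$: $S^{n-1}$ is the unit sphere with spherical measure $\sigma$ and $|\cdot|$ is volume. $\mathcal K_0$ is the set of convex bodies (compact convex sets) containing the origin in their interior; $h_K(u)=\max_{x\in K}\langle x,u\rangle$. $\mathcal F_0$ is the set of $K\in\mathcal K_0$ whose surface area measure $S(K,\cdot)$ on $S^{n-1}$ is absolutely continuous with respect to $\sigma$, with density $f_K$ (curvature function); $\mathcal F_0^+$ is the set of $K\in\mathcal F_0$ with $f_K$ continuous and positive on $S^{n-1}$. For $p\in\mathbb R$, $f_p(K,u)=h_K(u)^{1-p}f_K(u)$. The mixed $p$-affine surface area of $K_1,\dots,K_n\in\mathcal F_0^+$, for $p\ne-n$, is $$as_p(K_1,\dots,K_n)=\int_{S^{n-1}}\prod_{i=1}^n[f_p(K_i,u)]^{\frac1{n+p}}\,d\sigma(u).$$ $\mathcal S_0$ is the set of sets $L\subset\mathbb R^n$, star-convex about $0$, whose radial function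 $\rho_L(u)=\max\{\lambda\ge0:\lambda u\in L\}$, $u\in S^{n-1}$, is positive and continuous; $|L|=\frac1n\int_{S^{n-1}}\rho_L^n\,d\sigma$. For $L\in\mathcal S_0$, $$V_p(\mathbf K;L^\circ,\dots,L^\circ)=\frac1n\int_{S^{n-1}}\prod_{i=1}^n\big[\rho_L(u)^{-p}f_p(K_i,u)\big]^{\frac1n}d\sigma(u).$$ *)

(* Defs.v *)
From HB Require Import structures.
From mathcomp Require Import all_boot all_order all_algebra.
From mathcomp Require Import all_classical all_reals all_analysis.

Set Implicit Arguments.
Unset Strict Implicit.
Unset Printing Implicit Defensive.

Import Order.TTheory GRing.Theory Num.Theory.
Import numFieldNormedType.Exports.

Local Open Scope classical_set_scope.
Local Open Scope ring_scope.

(* R^n is represented by 'rV[R]_n, with its Borel sigma-algebra. *)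
HB.instance Definition _ (R : realType) (n : nat) :=
  @isMeasurable.Build (sigma_display (@open 'rV[R]_n)) 'rV[R]_n
    <<s (@open 'rV[R]_n) >> (@sigma_algebra0 _ _ _) (@sigma_algebraC _ _)
    (@sigma_algebra_bigcup _ _ _).

Section Euclidean.
Context {R : realType} {n : nat}.
Implicit Types (x y : 'rV[R]_n) (A : set 'rV[R]_n).

Definition dot x y : R := \sum_(i < n) x 0 i * y 0 i.

(* The norm that the library puts on 'rV[R]_n is the sup norm; it induces the
   same topology, but lengths have to be measured with this one. *)
Definition enorm x : R := Num.sqrt (dot x x).

Definition sphere : set 'rV[R]_n := [set u | enorm u = 1].

Definition unit_ball : set 'rV[R]_n := [set x | enorm x <= 1].

Definition ediam A : \bar R :=
  ereal_sup [set (enorm (xy.1 - xy.2))%:E | xy in A `*` A].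

End Euclidean.

Arguments sphere : clear implicits.
Arguments unit_ball : clear implicits.

(* Lebesgue measure on R^n, as an iterated product measure; R^0 is a point of
   mass 1. *)
Fixpoint volume {R : realType} (n : nat) : set 'rV[R]_n -> \bar R :=
  match n return set 'rV[R]_n -> \bar R with
  | 0 => dirac (0 : 'rV[R]_0)
  | m.+1 => pushforward (lebesgue_measure \x volume (n := m))%E
              (fun p => row_mx (const_mx p.1 : 'rV[R]_1) p.2 : 'rV[R]_m.+1)
  end.

Arguments volume {R n}.

Section Hausdorff.
Context {R : realType} {n : nat}.
Local Open Scope ereal_scope.

(* The empty set is treated apart because its ediam is -oo, and because it must
   not contribute 0 ^+ 0 = 1 when m = 0. *)
Definition hausdorff_gauge (m : nat) (U : set 'rV[R]_n) : \bar R :=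
  if `[< U = set0 >] then 0 else (ediam U * (2^-1)%:E) ^+ m.

Definition hausdorff_content (m : nat) (delta : R) (A : set 'rV[R]_n) :
    \bar R :=
  ereal_inf [set \sum_(0 <= k <oo) hausdorff_gauge m (U k) | U in
    [set U : nat -> set 'rV[R]_n | A `<=` \bigcup_k U k /\
                                  forall k, ediam (U k) <= delta%:E]].

(* The m-dimensional Hausdorff measure in R^n, normalized so that for m = n it is
   Lebesgue measure. *)
Definition hausdorff_measure (m : nat) (A : set 'rV[R]_n) : \bar R :=
  volume (unit_ball R m) *
  ereal_sup [set hausdorff_content m delta A | delta in [set d | (0 < d)%R]].

End Hausdorff.

Section Bodies.
Context {R : realType} {n : nat}.
Implicit Types (K L A : set 'rV[R]_n) (u : 'rV[R]_n).

Definition cone A : set 'rV[R]_n :=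
  [set t *: u | t in [set t : R | 0 < t <= 1] & u in A `&` sphere R n].

(* Spherical measure, by polar coordinates. *)
Definition sigma A : \bar R := (n%:R%:E * volume (cone A))%E.

(* K is in K_0 *)
Definition convex_body0 K :=
  [/\ convex_set K, compact K & interior K 0].

Definition support_fun K u : R := sup [set dot x u | x in K].

(* S(K, A) is the (n-1)-dimensional Hausdorff measure of the set of boundary
   points of K at which some u in A is an outer unit normal vector. *)
Definition surface_area_measure K A : \bar R :=
  hausdorff_measure n.-1
    [set x | K x /\ exists2 u, (A `&` sphere R n) u & dot x u = support_fun K u].

(* K is in F_0 *)
Definition has_curvature_fun K :=
  convex_body0 K /\ surface_area_measure K `<< sigma.

Definition is_density K (f : 'rV[R]_n -> R) :=
  [/\ measurable_fun (sphere R n) f,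
      (forall u, sphere R n u -> 0 <= f u) &
      forall A, measurable A ->
        surface_area_measure K A = (\int[sigma]_(u in A `&` sphere R n) (f u)%:E)%E].

(* The density f_K is determined sigma-almost everywhere only; when one of its
   versions is continuous on the sphere, f_K is taken to be such a version. *)
Definition curvature_fun K : 'rV[R]_n -> R :=
  xget (xget (cst 0) [set f | is_density K f])
    [set f | is_density K f /\ {within sphere R n, continuous f}].

(* K is in F_0^+ *)
Definition has_pos_cont_curvature_fun K :=
  [/\ has_curvature_fun K,
      {within sphere R n, continuous (curvature_fun K)} &
      forall u, sphere R n u -> 0 < curvature_fun K u].

Definition p_curvature_fun (p : R) K u : R :=
  support_fun K u `^ (1 - p) * curvature_fun K u.

Definition mixed_affine_surface_area (p : R) (K : 'I_n -> set 'rV[R]_n) :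
    \bar R :=
  (\int[sigma]_(u in sphere R n)
     (\prod_(i < n) p_curvature_fun p (K i) u `^ (n%:R + p)^-1)%:E)%E.

Definition radii L u : set R := [set l | 0 <= l /\ L (l *: u)].

Definition radial_fun L u : R := sup (radii L u).

(* L is in S_0; the second condition says that the maximum in the definition of the radial
   function exists. *)
Definition star_body0 L :=
  [/\ (forall x t, L x -> 0 <= t <= 1 -> L (t *: x)),
      (forall u, sphere R n u ->
         has_ubound (radii L u) /\ radii L u (radial_fun L u)),
      (forall u, sphere R n u -> 0 < radial_fun L u) &
      {within sphere R n, continuous (radial_fun L)}].

(* V_p(K; L°, ..., L°) *)
Definition mixed_p_volume_polar (p : R) (K : 'I_n -> set 'rV[R]_n) L : \bar R :=
  (n%:R^-1%:E * \int[sigma]_(u in sphere R n)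
     (\prod_(i < n)
        (radial_fun L u `^ (- p) * p_curvature_fun p (K i) u) `^ n%:R^-1)%:E)%E.

End Bodies.

(* Main.v *)
Require Import Defs.
From HB Require Import structures.
From mathcomp Require Import all_boot all_order all_algebra.
From mathcomp Require Import all_classical all_reals all_analysis.
From mathcomp Require Import measurable_realfun ring.

(* Write g for the geometric mean of the functions f_p(K_i, .), a = n / (n + p)
   and b = p / (n + p), so that a + b = 1. In polar coordinates n |L| is the
   integral of rho_L^n over the sphere, and n V_p is that of rho_L^(-p) g. Since
   (rho_L^(-p) g)^a (rho_L^n)^b = g^a pointwise, whatever L is, both bounds are
   Hoelder's inequality with exponents a and b: the usual one when a and b are
   nonnegative, and the reverse one when one of them is negative. Equality holds
   for the star body with rho_L = g^(1 / (n + p)), for which the two factors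
   coincide.

   The polar formula is obtained by cutting the sphere into the sets on which
   c^k <= rho_L / m < c^(k+1), where m is the minimum of rho_L: on each of them
   rho_L is constant up to the factor c, so that the definition of the spherical
   measure and the homogeneity of volume give the formula up to a factor c^n;
   then c tends to 1. *)

Set Implicit Arguments.
Unset Strict Implicit.
Unset Printing Implicit Defensive.

Import Order.TTheory GRing.Theory Num.Theory.
Import numFieldNormedType.Exports.

Local Open Scope classical_set_scope.
Local Open Scope ring_scope.

Lemma measurable_preimageT d1 d2 (T1 : measurableType d1) (T2 : measurableType d2)
  (f : T1 -> T2) (A : set T2) :
  measurable_fun setT f -> measurable A -> measurable (f @^-1` A).
Proof. by move=> mf mA; rewrite -[X in measurable X]setTI; exact: mf. Qed.

(** * Borel sets and measurable maps of row vectors *)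

Section BorelRowVectors.
Context {R : realType} {n : nat}.
Implicit Types (A U : set 'rV[R]_n) (x : 'rV[R]_n).

Lemma open_measurable_rV U : open U -> measurable U.
Proof. exact: sub_sigma_algebra. Qed.

Lemma closed_measurable_rV A : closed A -> measurable A.
Proof. by move=> /closed_openC/open_measurable_rV/measurableC; rewrite setCK. Qed.

Let box (q : 'rV[rat]_n) (k : nat) : set 'rV[R]_n :=
  [set v | forall i, `|v 0 i - ratr (q 0 i)| < k.+1%:R^-1].

(** Boxes with rational centre and half-width [k.+1%:R^-1] form a countable family, so this union
    can be used in a sigma-algebra. *)
Let open_bigcup_box U : open U ->
  U = \bigcup_(qk in [set qk : 'rV[rat]_n * nat | box qk.1 qk.2 `<=` U])
        box qk.1 qk.2.
Proof.
move=> oU; apply/seteqP; split => [v Uv|v [[q k] /= + kv]]; last exact.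
have [e e0 veU] : exists2 e : R, 0 < e & ball v e `<=` U.
  by have /nbhs_ballP[e /= e0 veU] := open_nbhs_nbhs (conj oU Uv); exists e.
(* Half of [e], since both [v] and a point [w] of the box are compared with the rational centre. *)
have [k ke] : exists k : nat, k.+1%:R^-1 < e / 2.
  exists (Num.truncn (e / 2)^-1).
  by rewrite invf_plt ?posrE ?divr_gt0// truncnS_gt.
have qP i : {q : rat | `|v 0 i - ratr q| < k.+1%:R^-1}.
  apply: cid.
  have [|q /itvP qv] := @rat_in_itvoo R (v 0 i - k.+1%:R^-1) (v 0 i + k.+1%:R^-1).
    by rewrite ltrD2l (@lt_trans _ _ 0)// ?oppr_lt0 invr_gt0.
  by exists q; rewrite ltr_distlC !qv.
exists (\row_i projT1 (qP i), k) => /= [w|i].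
  move=> /= wq; apply: veU; split=> // i j; rewrite (ord1 i) /ball /=.
  rewrite (splitr e) (le_lt_trans (ler_distD (ratr ((\row_i projT1 (qP i)) 0 j)) _ _))//.
  apply: ltrD; last by rewrite distrC (lt_trans (wq _)).
  by rewrite mxE; apply: lt_trans ke; case: (qP j).
by rewrite mxE; case: (qP i).
Qed.

(** Open sets generate the sigma-algebra and are countable unions of boxes; the preimage of a box is
    a finite intersection of preimages of intervals under the coordinates of [f]. *)
Lemma measurable_fun_rV d (T : measurableType d) (D : set T) (f : T -> 'rV[R]_n) :
  measurable D -> (forall i, measurable_fun D (fun t => f t 0 i)) ->
  measurable_fun D f.
Proof.
move=> mD mf; apply: (measurability (@open 'rV[R]_n)) => // _ [U oU <-].
rewrite (open_bigcup_box oU) preimage_bigcup setI_bigcupr bigcup_mkcond.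
apply: countable_bigcupT_measurable => // -[q k] /=.
case: ifPn => // _; rewrite /box.
rewrite (_ : _ `&` _ = \bigcap_(i in [set: 'I_n])
    (D `&` (fun t => f t 0 i) @^-1`
         `](ratr (q 0 i) - k.+1%:R^-1), (ratr (q 0 i) + k.+1%:R^-1)[%classic)
  `&` D).
  apply: measurableI => //.
  apply: fin_bigcap_measurable => // i _.
  exact: mf.
apply/seteqP; split => [t /= [Dt ft]|t /= [ft Dt]].
  by split=> // i _; split => //=; rewrite in_itv/= -ltr_distl; exact: ft.
by split=> // i; have [_ /=] := ft i I; rewrite in_itv/= -ltr_distl.
Qed.

Lemma within_continuous_measurable_rV A (f : 'rV[R]_n -> R) :
  measurable A -> {within A, continuous f} -> measurable_fun A f.
Proof.
move=> mA /continuousP cf; apply: (measurability _ (RGenOpens.measurableE R)).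
move=> _ [_ [a [b ->] <-]].
have /open_subspaceP[V oV VA] := cf _ (@interval_open _ (BRight a) (BLeft b) isT isT).
by rewrite setIC -VA; apply: measurableI => //; exact: open_measurable_rV.
Qed.

Lemma continuous_measurable_rV (f : 'rV[R]_n -> R) :
  continuous f -> measurable_fun setT f.
Proof.
move=> cf; apply: within_continuous_measurable_rV => //.
exact: continuous_subspaceT.
Qed.

Lemma coord_measurable (i : 'I_n) : measurable_fun setT (fun x => x 0 i : R).
Proof. by apply: continuous_measurable_rV => x; exact: coord_continuous. Qed.

End BorelRowVectors.

(** * The Euclidean norm, the sphere and radial projection *)

Section Enorm.
Context {R : realType} {n : nat}.
Implicit Types x y u : 'rV[R]_n.

Lemma dotZl (t : R) x y : dot (t *: x) y = t * dot x y.
Proof. by rewrite /dot mulr_sumr; apply: eq_bigr => i _; rewrite mxE mulrA. Qed.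

Lemma dotBr x y u : dot x (y - u) = dot x y - dot x u.
Proof.
by rewrite /dot -sumrB; apply: eq_bigr => i _; rewrite !mxE mulrBr.
Qed.

Lemma dotC x y : dot x y = dot y x.
Proof. by apply: eq_bigr => i _; rewrite mulrC. Qed.

Lemma dot_ge0 x : 0 <= dot x x.
Proof. by apply: sumr_ge0 => i _; rewrite -expr2 sqr_ge0. Qed.

Lemma enorm_ge0 x : 0 <= enorm x.
Proof. exact: sqrtr_ge0. Qed.

Lemma enormZ (t : R) x : enorm (t *: x) = `|t| * enorm x.
Proof.
rewrite /enorm dotZl dotC dotZl mulrA -expr2 sqrtrM ?sqr_ge0// sqrtr_sqr//.
Qed.

Lemma coord_le_enorm x i : `|x 0 i| <= enorm x.
Proof.
rewrite -sqrtr_sqr ler_wsqrtr// /dot (bigD1 i)//= expr2 lerDl.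
by apply: sumr_ge0 => j _; rewrite -expr2 sqr_ge0.
Qed.

Lemma enorm_eq0 x : (enorm x == 0) = (x == 0).
Proof.
apply/eqP/eqP => [x0|->]; last first.
  by rewrite /enorm /dot big1 ?sqrtr0// => i _; rewrite mxE mul0r.
apply/rowP => i; rewrite mxE; apply/eqP; rewrite -normr_le0 -x0.
exact: coord_le_enorm.
Qed.

Lemma enorm_gt0 x : (0 < enorm x) = (x != 0).
Proof. by rewrite lt_def enorm_ge0 andbT enorm_eq0. Qed.

Lemma enorm_continuous : continuous (@enorm R n).
Proof.
move=> x; apply: (@continuous_comp _ _ _ (fun x => dot x x) Num.sqrt); last first.
  exact: sqrt_continuous.
move: x; apply: continuous_big => [|i _ x]; first exact: add_continuous.
by apply: (@continuousM _ _ (fun x => x 0 i) (fun x => x 0 i));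
  exact: (@coord_continuous _ 1 n 0 i).
Qed.

Lemma enorm_measurable : measurable_fun setT (@enorm R n).
Proof. exact: (continuous_measurable_rV enorm_continuous). Qed.

Lemma unit_ball_measurable : measurable (unit_ball R n).
Proof.
rewrite (_ : unit_ball R n = @enorm R n @^-1` `]-oo, 1]%classic).
  exact: (measurable_preimageT enorm_measurable).
by apply/seteqP; split => x /=; rewrite in_itv.
Qed.

Lemma sphere_neq0 u : sphere R n u -> u != 0.
Proof. by rewrite -enorm_gt0 => ->. Qed.

Lemma sphere_closed : closed (sphere R n).
Proof.
rewrite (_ : sphere R n = @enorm R n @^-1` [set 1])//.
by apply: preimage_closed; [move=> x _; exact: enorm_continuous|exact: closed_eq].
Qed.

Lemma sphere_compact : compact (sphere R n).
Proof.
apply: bounded_closed_compact; last exact: sphere_closed.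
exists 1; split => // M M1 u /= u1; apply: le_trans (ltW M1).
rewrite [leLHS](mx_normrE u); apply/bigmax_leP; split => // -[i j] _ /=.
by rewrite (ord1 i) -u1; exact: coord_le_enorm.
Qed.

Lemma sphere_measurable : measurable (sphere R n).
Proof. exact: (closed_measurable_rV sphere_closed). Qed.

(** The origin is sent to itself, off the sphere, so that preimages of subsets of the sphere never
    contain it. *)
Definition normalize x := (enorm x)^-1 *: x.

Lemma normalize_measurable : measurable_fun setT normalize.
Proof.
apply: measurable_fun_rV => // i; under eq_fun do rewrite mxE.
apply: measurable_funM; last exact: coord_measurable.
(* On nonnegative reals the inverse is the power with exponent -1, which is measurable on the whole
   line. *)
under eq_fun do rewrite -(powR_inv1 (enorm_ge0 _)).
exact: (measurableT_comp (measurable_powR (-1)) enorm_measurable).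
Qed.

Lemma sphere_normalize x : sphere R n (normalize x) <-> x != 0.
Proof.
rewrite /sphere /= enormZ; split => [+|x0].
  apply: contra_eqN => /eqP ->.
  by rewrite (eqP (_ : enorm 0 == 0)) ?enorm_eq0// mulr0 eq_sym oner_eq0.
by rewrite ger0_norm ?invr_ge0 ?enorm_ge0// mulVf// enorm_eq0.
Qed.

Lemma normalizeK x : enorm x *: normalize x = x.
Proof.
have [->|x0] := eqVneq x 0; first by rewrite /normalize !scaler0.
by rewrite scalerA mulfV ?scale1r// enorm_eq0.
Qed.

Lemma normalizeZ (t : R) x : 0 < t -> normalize (t *: x) = normalize x.
Proof.
move=> t0; rewrite /normalize enormZ gtr0_norm// scalerA invfM mulrAC.
by rewrite mulVf ?mul1r// gt_eqF.
Qed.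

Lemma normalize_sphere u : sphere R n u -> normalize u = u.
Proof. by move=> u1; rewrite /normalize u1 invr1 scale1r. Qed.

End Enorm.

(** * Lebesgue measure under dilations of the line *)

Section LebesgueScaling.
Context {R : realType}.

(** Uniqueness of Lebesgue measure: [t] times its pushforward under [x |-> t * x] gives half-open
    intervals their length. *)
Lemma lebesgue_measure_scale (t : R) (A : set (measurableTypeR R)) :
  0 < t -> measurable A ->
  lebesgue_measure ((fun x : measurableTypeR R => t * x : measurableTypeR R) @^-1` A)
  = (t^-1%:E * lebesgue_measure A)%E.
Proof.
move=> t0 mA.
pose f (x : measurableTypeR R) : measurableTypeR R := t * x.
have mf : measurable_fun setT f by exact: measurable_funM.
pose k : {nonneg R} := NngNum (ltW t0).
(* The measure structure of [pushforward] depends on the measurability proof,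
   which [pose] abstracts: [mu] is a function of that proof. *)
pose mu := mscale k (pushforward (@lebesgue_measure R) f).
have muE X : mu mf X = (t%:E * lebesgue_measure (f @^-1` X))%E by [].
have -> : lebesgue_measure A = mu mf A.
  apply: lebesgue_measure_unique => // _ [[a b]] _ <-.
  rewrite [RHS]muE (_ : f @^-1` _ = `]a / t, b / t]%classic).
    rewrite !lebesgue_measure_itv/= !lte_fin ltr_pM2r ?invr_gt0//.
    case: ifPn => // _; last by rewrite mule0.
    by rewrite !EFinN -!EFinD -EFinM; congr EFin; rewrite -mulrBl mulrC divfK// gt_eqF.
  apply/seteqP; split => x /=; rewrite !in_itv/= /f.
    by rewrite ltr_pdivrMr// ler_pdivlMr// mulrC.
  by rewrite ltr_pdivrMr// ler_pdivlMr// mulrC.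
by rewrite muE muleA -EFinM mulVf ?mul1e// gt_eqF.
Qed.

End LebesgueScaling.

(** * Volume as a sigma-finite measure, and its homogeneity *)

Section Volume.
Context {R : realType}.

Let cons_rV m (p : measurableTypeR R * 'rV[R]_m) : 'rV[R]_m.+1 :=
  row_mx (const_mx p.1 : 'rV[R]_1) p.2.

Let cons_rV0 m p : @cons_rV m p 0 0 = p.1.
Proof.
transitivity ((const_mx p.1 : 'rV[R]_1) 0 0); last by rewrite mxE.
rewrite -[RHS](row_mxEl _ p.2).
by apply: (congr1 (fun j => cons_rV p 0 j)); exact: val_inj.
Qed.

Let cons_rVS m p i : @cons_rV m p 0 (lift ord0 i) = p.2 0 i.
Proof.
rewrite -[RHS](row_mxEr (const_mx p.1 : 'rV[R]_1)).
by apply: (congr1 (fun j => cons_rV p 0 j)); exact: val_inj.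
Qed.

Let measurable_cons_rV m : measurable_fun setT (@cons_rV m).
Proof.
apply: measurable_fun_rV => // i; case: (unliftP ord0 i) => [j ->|->].
  under eq_fun do rewrite cons_rVS.
  exact: (measurableT_comp (coord_measurable j) measurable_snd).
under eq_fun do rewrite cons_rV0.
exact: measurable_fst.
Qed.

Let cube n (r : R) : set 'rV[R]_n := [set x | forall i, `|x 0 i| <= r].

Let measurable_cube n r : measurable (@cube n r).
Proof.
rewrite (_ : cube r = \bigcap_(i in [set: 'I_n])
    (fun x => x 0 i) @^-1` `[- r, r]%classic).
  apply: fin_bigcap_measurable => // i _.
  exact: (measurable_preimageT (coord_measurable i)).
apply/seteqP; split=> x /= xr i; first by rewrite /= in_itv/= -ler_norml.
by have /= := xr i I; rewrite in_itv/= -ler_norml.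
Qed.

Let preimage_cube m r : @cons_rV m @^-1` cube r = `[- r, r]%classic `*` cube r.
Proof.
apply/seteqP; split => [[x v] /= xvr|[x v] /= [xr vr] i].
  split; first by rewrite /= in_itv/= -ler_norml; have := xvr 0; rewrite cons_rV0.
  by move=> i; have := xvr (lift ord0 i); rewrite cons_rVS.
case: (unliftP ord0 i) => [j ->|->]; first by rewrite cons_rVS; exact: vr.
by rewrite cons_rV0 ler_norml; rewrite /= in_itv in xr.
Qed.

Let cube_sigma_finite n (mu : {measure set 'rV[R]_n -> \bar R}) :
  (forall r, mu (cube r) < +oo)%E -> sigma_finite setT mu.
Proof.
move=> muoo; exists (fun k => cube k%:R); last by [].
apply/esym/seteqP; split => // x _.
have [k] : exists k : nat, enorm x < k.+1%:R.
  by exists (Num.truncn (enorm x)); exact: truncnS_gt.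
move=> xk; exists k.+1 => // i.
by rewrite (le_trans (coord_le_enorm _ _))// ltW.
Qed.

(** The induction carries finiteness on cubes along: it makes the measure in dimension [m]
    sigma-finite, as needed for its product with Lebesgue measure to be a measure again. *)
Let volume_is_measure n : exists mu : {measure set 'rV[R]_n -> \bar R},
  volume = mu :> (set _ -> _) /\ (forall r, mu (cube r) < +oo)%E.
Proof.
elim: n => [|m [mu [volm muoo]]].
  by exists (dirac (0 : 'rV[R]_0)); split => // r; rewrite /= diracE ltry.
have smu := cube_sigma_finite muoo.
pose H1 := isSFinite.Build _ _ _ _ (sfinite_measure_sigma_finite smu).
pose H2 := isSigmaFinite.Build _ _ _ _ smu.
pose mu' := HB.pack_for (SigmaFiniteMeasure.type 'rV[R]_m R) (Measure.sort mu) H1 H2.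
pose nu_ : {measure set 'rV[R]_m.+1 -> \bar R} :=
  pushforward ((@lebesgue_measure R) \x mu')%E (@cons_rV m).
pose nu := nu_ (@measurable_cons_rV m).
exists nu; split => [|r]; first by rewrite /= volm.
have -> : nu (cube r) = ((@lebesgue_measure R) \x mu')%E (@cons_rV m @^-1` cube r).
  by [].
rewrite preimage_cube product_measure1E//.
apply: lte_mul_pinfty; last exact: muoo.
  exact: measure_ge0.
by rewrite /= lebesgue_measure_itv/=; case: ifPn.
Qed.

Let volume0 n : volume (set0 : set 'rV[R]_n) = 0%E.
Proof. by have [mu [-> _]] := volume_is_measure n; exact: measure0. Qed.

Let volume_ge0 n (A : set 'rV[R]_n) : (0 <= volume A)%E.
Proof. by have [mu [-> _]] := volume_is_measure n; exact: measure_ge0. Qed.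

Let volume_sigma_additive n : semi_sigma_additive (@volume R n).
Proof.
by have [mu [-> _]] := volume_is_measure n; exact: measure_semi_sigma_additive.
Qed.

HB.instance Definition _ n := isMeasure.Build _ _ _ (@volume R n)
  (@volume0 n) (@volume_ge0 n) (@volume_sigma_additive n).

Let volume_sigma_finite n : sigma_finite setT (@volume R n).
Proof.
have [mu [e mucube]] := volume_is_measure n.
by apply: cube_sigma_finite => r; have := mucube r; rewrite -e.
Qed.

HB.instance Definition _ n := Measure_isSigmaFinite.Build _ _ _ (@volume R n)
  (@volume_sigma_finite n).

Lemma scaler_measurable n (t : R) :
  measurable_fun setT (fun x : 'rV[R]_n => t *: x).
Proof.
apply: measurable_fun_rV => // i; under eq_fun do rewrite mxE.
by apply: measurable_funM => //; exact: coord_measurable.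
Qed.

(** Induction on the dimension. A product measure is determined by its values on rectangles, and
    there [t ^+ m.+1] times the pushforward under the dilation agrees with it, by the case of the
    line and the induction hypothesis. *)
Lemma volume_scale n (t : R) (A : set 'rV[R]_n) : 0 < t -> measurable A ->
  volume ((fun x => t *: x) @^-1` A) = ((t^-1 ^+ n)%:E * volume A)%E.
Proof.
move=> t0; elim: n A => [|m ih] A mA.
  rewrite expr0 mul1e /=; congr dirac; apply/funext => v /=.
  by congr A; apply/rowP => -[].
pose s (p : measurableTypeR R * 'rV[R]_m) : measurableTypeR R * 'rV[R]_m :=
  (t * p.1, t *: p.2).
have ms : measurable_fun setT s.
  apply: measurable_fun_pair; first by apply: measurable_funM => //; exact: measurable_fst.
  exact: (measurableT_comp (@scaler_measurable m t) measurable_snd).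
have k0 : 0 <= t ^+ m.+1 by exact/exprn_ge0/ltW.
pose k : {nonneg R} := NngNum k0.
pose lv : {measure set _ -> \bar R} := ((@lebesgue_measure R) \x (@volume R m))%E.
pose mu := mscale k (pushforward lv s).
pose B := @cons_rV m @^-1` A.
have mB : measurable B by exact: (measurable_preimageT (@measurable_cons_rV m)).
have muE X : mu ms X =
    ((t ^+ m.+1)%:E * (@lebesgue_measure R \x @volume R m) (s @^-1` X))%E by [].
have -> : volume A = mu ms B.
  change (lv B = mu ms B).
  apply: (@product_measure_unique _ _ _ _ R (@lebesgue_measure R) (@volume R m)
    (mu ms)) => // C D mC mD.
  rewrite [LHS]muE (_ : s @^-1` _ =
    ((fun x => t * x) @^-1` C) `*` ((fun x => t *: x) @^-1` D))//.
  rewrite product_measure1E; last 2 first.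
  - by apply: measurable_preimageT mC; exact: measurable_funM.
  - exact: (measurable_preimageT (@scaler_measurable m t)).
  rewrite /= lebesgue_measure_scale// ih// muleACA -EFinM.
  by rewrite -exprS [LHS]muleA -EFinM -exprMn mulfV ?gt_eqF// expr1n mul1e.
rewrite muE muleA -EFinM -exprMn mulVf ?gt_eqF// expr1n mul1e.
(* It remains to see that prepending a coordinate commutes with dilation. *)
congr product_measure1; apply/funext => p /=; congr A.
apply/rowP => i; rewrite mxE; case: (unliftP ord0 i) => [j ->|->].
  by rewrite [in LHS]cons_rVS [in RHS](cons_rVS (s p)) mxE.
by rewrite [in LHS]cons_rV0 [in RHS](cons_rV0 (s p)).
Qed.

Lemma volume_unit_ball_lty n : (volume (unit_ball R n) < +oo)%E.
Proof.
have [mu [-> mucube]] := volume_is_measure n.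
apply: le_lt_trans (mucube 1); apply: le_measure; rewrite ?inE//.
  exact: unit_ball_measurable.
by move=> x x1 i; exact: le_trans (coord_le_enorm _ _) x1.
Qed.

End Volume.

(** This is how the factor in the comparison of volume with the spherical integral is let tend to
    1. *)
Lemma le_ereal_gt1P (R : realType) (x y : \bar R) :
  (0 <= y)%E -> (forall c : R, 1 < c -> (x <= c%:E * y)%E) -> (x <= y)%E.
Proof.
case: y => [y|_ _|//]; rewrite ?leey// lee_fin => y0 xy.
(* This [c] gives [c * y <= y + e]; the denominator is [y + 1] because [y] may be 0. *)
apply/lee_addgt0Pr => e e0; pose c := 1 + e / (y + 1).
have y1 : 0 < y + 1 by rewrite ltr_wpDl.
apply: (le_trans (xy c _)); first by rewrite ltrDl divr_gt0.
rewrite -EFinM -EFinD lee_fin /c mulrDl mul1r lerD2l -mulrA ger_pMr//.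
by rewrite mulrC ler_pdivrMr// mul1r lerDl.
Qed.

(** * Spherical measure as a finite measure *)

Section SphericalMeasure.
Context {R : realType} {n : nat}.
Implicit Types A : set 'rV[R]_n.
Local Notation S := (sphere R n).

Lemma coneE A :
  cone A = @normalize R n @^-1` (A `&` S) `&` unit_ball R n.
Proof.
apply/seteqP; split => [x [t /= /andP[t0 t1]] [u [Au Su] <-]|x [[Ax Sx] x1]].
  split => /=; first by rewrite normalizeZ// normalize_sphere.
  by rewrite /unit_ball /= enormZ Su mulr1 gtr0_norm.
have := Sx; rewrite sphere_normalize -enorm_gt0 => x0.
by exists (enorm x); [rewrite /= x0|exists (normalize x) => //; exact: normalizeK].
Qed.

Lemma cone_measurable A : measurable A -> measurable (cone A).
Proof.
move=> mA; rewrite coneE; apply: measurableI; last exact: unit_ball_measurable.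
apply: (measurable_preimageT normalize_measurable).
by apply: measurableI => //; exact: sphere_measurable.
Qed.

(** By [coneE], restricting volume to the unit ball, pushing it forward under [normalize],
    restricting to the sphere and multiplying by [n] yields [sigma]. *)
Let sigma_is_measure :
  exists mu : {measure set 'rV[R]_n -> \bar R}, sigma = mu :> (set _ -> _).
Proof.
pose nu_ : {measure set 'rV[R]_n -> \bar R} :=
  pushforward (mrestr (@volume R n) unit_ball_measurable) (@normalize R n).
pose nu := nu_ normalize_measurable.
exists (mscale (NngNum (ler0n R n)) (mrestr nu sphere_measurable)).
by apply/funext => A; rewrite /sigma coneE.
Qed.

Let sigma0 : @sigma R n set0 = 0%E.
Proof. by have [mu ->] := sigma_is_measure; exact: measure0. Qed.

Let sigma_ge0 A : (0 <= sigma A)%E.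
Proof. by have [mu ->] := sigma_is_measure; exact: measure_ge0. Qed.

Let sigma_sigma_additive : semi_sigma_additive (@sigma R n).
Proof.
by have [mu ->] := sigma_is_measure; exact: measure_semi_sigma_additive.
Qed.

HB.instance Definition _ := isMeasure.Build _ _ _ (@sigma R n)
  sigma0 sigma_ge0 sigma_sigma_additive.

Lemma sigma_lty A : measurable A -> (sigma A < +oo)%E.
Proof.
move=> mA; rewrite /sigma; apply: lte_mul_pinfty => //.
apply: le_lt_trans (volume_unit_ball_lty n); apply: le_measure; rewrite ?inE//.
- exact: cone_measurable.
- exact: unit_ball_measurable.
- by rewrite coneE => x [].
Qed.

End SphericalMeasure.

(** * Volume in polar coordinates *)

Section PolarCoordinates.
Context {R : realType} {n : nat}.
Implicit Types (A : set 'rV[R]_n) (r : 'rV[R]_n -> R).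
Local Notation S := (sphere R n).

(** The part of the body with radial function [r] that lies in the directions of [A]. The origin is
    left out, as its [normalize] is not on the sphere. *)
Definition star_region r A : set 'rV[R]_n :=
  [set x | (A `&` S) (normalize x) /\ enorm x <= r (normalize x)].

Lemma star_region_measurable r A : measurable_fun S r -> measurable A ->
  measurable (star_region r A).
Proof.
move=> mr mA.
pose D := @normalize R n @^-1` (A `&` S).
have mD : measurable D.
  apply: (measurable_preimageT normalize_measurable).
  by apply: measurableI => //; exact: sphere_measurable.
pose h x := r (normalize x) - enorm x.
have mh : measurable_fun D h.
  apply: measurable_funB; last exact: measurable_funTS enorm_measurable.
  apply: (measurable_comp sphere_measurable) mr _.
    by move=> _ [x [Ax Sx] <-].
  exact: measurable_funTS normalize_measurable.
rewrite (_ : star_region r A = D `&` h @^-1` `[0, +oo[%classic).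
  exact: mh.
by apply/seteqP; split=> x /=; rewrite in_itv/= andbT subr_ge0.
Qed.

(** For a constant radius the region is the cone over [A] dilated by [a], so that homogeneity of
    volume applies. *)
Lemma volume_star_region_cst (a : R) A : 0 < a -> measurable A ->
  (n%:R%:E * volume (star_region (cst a) A) = (a ^+ n)%:E * sigma A)%E.
Proof.
move=> a0 mA.
have -> : star_region (cst a) A = (fun x => a^-1 *: x) @^-1` cone A.
  rewrite coneE; apply/seteqP; split => x /=;
    rewrite /star_region /unit_ball /= normalizeZ ?invr_gt0// enormZ
      gtr0_norm ?invr_gt0// mulrC ler_pdivrMr// mul1r.
    by case.
  by case.
rewrite volume_scale ?invr_gt0 ?invrK//; last exact: cone_measurable.
by rewrite /sigma muleCA.
Qed.

Lemma volume_star_region_le r (b : R) A : measurable_fun S r -> measurable A ->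
  0 < b -> (forall u, (A `&` S) u -> r u <= b) ->
  (n%:R%:E * volume (star_region r A) <= (b ^+ n)%:E * sigma A)%E.
Proof.
move=> mr mA b0 rb; rewrite -volume_star_region_cst//.
apply: lee_wpmul2l => //; apply: le_measure; rewrite ?inE.
- exact: star_region_measurable.
- exact: star_region_measurable.
- by move=> x [Ax xr]; split => //; exact: le_trans (rb _ Ax).
Qed.

Lemma volume_star_region_ge r (a : R) A : measurable_fun S r -> measurable A ->
  0 < a -> (forall u, (A `&` S) u -> a <= r u) ->
  ((a ^+ n)%:E * sigma A <= n%:R%:E * volume (star_region r A))%E.
Proof.
move=> mr mA a0 ra; rewrite -volume_star_region_cst//.
apply: lee_wpmul2l => //; apply: le_measure; rewrite ?inE.
- exact: star_region_measurable.
- exact: star_region_measurable.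
- by move=> x [Ax xr]; split => //; exact: le_trans (ra _ Ax).
Qed.

Lemma volume_star_region_bigcup r (F : nat -> set 'rV[R]_n) :
  measurable_fun S r -> (forall k, measurable (F k)) -> trivIset setT F ->
  volume (star_region r (\bigcup_k F k)) =
  (\sum_(k <oo) volume (star_region r (F k)))%E.
Proof.
move=> mr mF tF.
have mrF k : measurable (star_region r (F k)) by exact: star_region_measurable.
rewrite -measure_semi_bigcup//.
- congr volume; apply/seteqP; split => [x [[[k _ Fk] Sx] xr]|x [k _ [[Fk Sx] xr]]].
    by exists k.
  by split=> //; split=> //; exists k.
- apply/trivIsetP => i j _ _ ij; apply/seteqP; split => // x [[[Fi _] _] [[Fj _] _]].
  have /trivIsetP/(_ i j I I ij) FF := tF.
  by have : (F i `&` F j) (normalize x) by []; rewrite FF.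
- exact: bigcup_measurable.
Qed.

Lemma integral_pow_le r (b : R) A : measurable_fun S r -> measurable A -> A `<=` S ->
  (forall u, A u -> 0 <= r u <= b) ->
  (\int[sigma]_(u in A) (r u ^+ n)%:E <= (b ^+ n)%:E * sigma A)%E.
Proof.
move=> mr mA AS rb; rewrite -integral_cst//.
apply: ge0_le_integral => //.
- by move=> u /rb /andP[r0 _]; rewrite lee_fin exprn_ge0.
- apply/measurable_EFinP; apply: measurable_funX.
  exact: (measurable_funS sphere_measurable AS mr).
- by move=> u /rb /andP[r0 rb']; rewrite lee_fin lerXn2r// nnegrE// (le_trans r0).
Qed.

Lemma integral_pow_ge r (a : R) A : measurable_fun S r -> measurable A -> A `<=` S ->
  0 <= a -> (forall u, A u -> a <= r u) ->
  ((a ^+ n)%:E * sigma A <= \int[sigma]_(u in A) (r u ^+ n)%:E)%E.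
Proof.
move=> mr mA AS a0 ra; rewrite -integral_cst//.
apply: ge0_le_integral => //.
- by move=> u _; rewrite lee_fin exprn_ge0.
- apply/measurable_EFinP; apply: measurable_funX.
  exact: (measurable_funS sphere_measurable AS mr).
- by move=> u /ra ar; rewrite lee_fin lerXn2r// nnegrE// (le_trans a0).
Qed.

Section Sandwich.
Variables (n_gt0 : (0 < n)%N) (r : 'rV[R]_n -> R) (m : R).
Hypotheses (mr : measurable_fun S r) (m0 : 0 < m) (mler : forall u, S u -> m <= r u).

(** On a logarithmic scale the shells have equal width [e], so that on each of them [r] varies at
    most by the factor [expR e]. *)
Let shell (e : R) (k : nat) : set 'rV[R]_n :=
  S `&` (fun u => ln (r u / m)) @^-1` `[k%:R * e, k.+1%:R * e[%classic.

Let measurable_shell e k : measurable (shell e k).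
Proof.
apply: (_ : measurable_fun S (fun u => ln (r u / m))) => //.
- apply: measurableT_comp; first exact: measurable_ln.
  by apply: measurable_funM => //; exact: measurable_cst.
- exact: sphere_measurable.
Qed.

Let shell_bounds e k u : shell e k u ->
  m * expR (k%:R * e) <= r u <= (m * expR (k%:R * e)) * expR e.
Proof.
move=> [Su]; have r0 := lt_le_trans m0 (mler Su).
have rm0 : 0 < r u / m by exact: divr_gt0.
rewrite /= in_itv/= -mulrA -expRD -[X in expR (_ + X)]mul1r -mulrDl natr1 => /andP[kr rk].
rewrite -ler_expR in kr; rewrite -ltr_expR in rk; rewrite !lnK// in kr rk.
rewrite ler_pdivlMr// in kr; rewrite ltr_pdivrMr// in rk.
by rewrite mulrC kr mulrC ltW.
Qed.

Let trivIset_shell e : 0 < e -> trivIset setT (shell e).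
Proof.
move=> e0; apply/trivIsetP => i j _ _.
wlog ij : i j / (i < j)%N => [h|_].
  by rewrite neq_ltn => /orP[] ij; [|rewrite setIC]; apply: h; rewrite // ltn_eqF.
apply/seteqP; split => // u [[_]] /=; rewrite in_itv/= => /andP[_ ui] [_] /=.
rewrite in_itv/= => /andP[uj _]; have := le_lt_trans uj ui.
by rewrite ltr_pM2r// ltr_nat ltnNge ij.
Qed.

Let bigcup_shell e : 0 < e -> \bigcup_k shell e k = S.
Proof.
move=> e0; apply/seteqP; split => [u [k _ []]//|u Su].
(* The bound [m <= r u] makes the logarithm nonnegative, so truncating this quotient gives the index
   of the shell of [u]. *)
have ln0 : 0 <= ln (r u / m) / e.
  by rewrite divr_ge0 ?ln_ge0// ?ler_pdivlMr ?mul1r ?mler// ltW.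
have /andP[kl kr] := truncn_itv ln0.
exists (Num.truncn (ln (r u / m) / e)) => //; split => //=.
by rewrite in_itv/= -ler_pdivlMr// kl -ltr_pdivrMr.
Qed.

(** Stated for two set functions because it is used twice: volume and integral exchange the roles of
    [mu1] and [mu2], and each use gives one inequality. *)
Let sandwich (mu1 mu2 : set 'rV[R]_n -> \bar R) :
  (forall F : nat -> set 'rV[R]_n, (forall k, measurable (F k)) ->
     trivIset setT F -> \bigcup_k F k = S ->
     (mu1 S = \sum_(k <oo) mu1 (F k) /\ mu2 S = \sum_(k <oo) mu2 (F k))%E) ->
  (forall A, 0 <= mu1 A)%E -> (forall A, 0 <= mu2 A)%E ->
  (forall A b, measurable A -> A `<=` S -> 0 < b ->
     (forall u, A u -> r u <= b) -> (mu1 A <= (b ^+ n)%:E * sigma A)%E) ->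
  (forall A a, measurable A -> A `<=` S -> 0 < a ->
     (forall u, A u -> a <= r u) -> ((a ^+ n)%:E * sigma A <= mu2 A)%E) ->
  (mu1 S <= mu2 S)%E.
Proof.
move=> mu12 mu1_ge0 mu2_ge0 mu1_le mu2_ge; apply: le_ereal_gt1P => // c c1.
(* With this width, [expR e ^+ n = c]: the bounds on a shell enter with the power [n]. *)
pose e := ln c / n%:R.
have e0 : 0 < e by rewrite divr_gt0 ?ln_gt0// ltr0n.
have [-> ->] := mu12 _ (measurable_shell e) (trivIset_shell e0) (bigcup_shell e0).
rewrite -nneseriesZl//; apply: lee_nneseries => // k _.
pose a := m * expR (k%:R * e).
have a0 : 0 < a by rewrite mulr_gt0 ?expR_gt0.
have kS : shell e k `<=` S by move=> u [].
apply: (@le_trans _ _ (((a * expR e) ^+ n)%:E * sigma (shell e k))%E).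
  apply: mu1_le => //; first by rewrite mulr_gt0 ?expR_gt0.
  by move=> u /shell_bounds /andP[].
have -> : (a * expR e) ^+ n = c * a ^+ n.
  rewrite exprMn mulrC -expRM_natl /e mulrCA mulfV ?mulr1 ?lnK//.
    by rewrite posrE (lt_trans _ c1).
  by rewrite pnatr_eq0 -lt0n.
rewrite EFinM -muleA lee_wpmul2l ?lee_fin ?(ltW (lt_trans _ c1))//.
by apply: mu2_ge => // u /shell_bounds /andP[].
Qed.

Lemma volume_polar : (n%:R%:E * volume (star_region r setT) =
  \int[sigma]_(u in S) (r u ^+ n)%:E)%E.
Proof.
have r0 u : S u -> 0 <= r u by move=> /mler; apply: le_trans; exact: ltW.
have -> : star_region r setT = star_region r S.
  by rewrite /star_region setTI setIid.
pose mu1 A := (n%:R%:E * volume (star_region r A))%E.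
(* The sign of [r] is known on the sphere only; the intersection makes [mu2] nonnegative on every
   set. *)
pose mu2 A := (\int[sigma]_(u in A `&` S) (r u ^+ n)%:E)%E.
have -> : (\int[sigma]_(u in S) (r u ^+ n)%:E = mu2 S)%E by rewrite /mu2 setIid.
have mu1_ge0 A : (0 <= mu1 A)%E by rewrite mule_ge0.
have mu2_ge0 A : (0 <= mu2 A)%E.
  by apply: integral_ge0 => u [_ /r0 ru]; rewrite lee_fin exprn_ge0.
have add F : (forall k, measurable (F k)) ->
    trivIset setT F -> \bigcup_k F k = S ->
    (mu1 S = \sum_(k <oo) mu1 (F k) /\ mu2 S = \sum_(k <oo) mu2 (F k))%E.
  move=> mF tF FS; have FSk k : F k `<=` S by rewrite -FS => u; exists k.
  split.
    by rewrite /mu1 -FS volume_star_region_bigcup// nneseriesZl.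
  rewrite /mu2 setIid; under eq_eseriesr do rewrite setIidl//.
  rewrite -[in LHS]FS ge0_integral_bigcup//.
    rewrite FS; apply/measurable_EFinP; exact: measurable_funX.
  by rewrite FS => u /r0 ru; rewrite lee_fin exprn_ge0.
apply/eqP; rewrite eq_le; apply/andP; split; rewrite -/(mu1 S).
  apply: sandwich => // A a mA AS a0 h.
    by apply: volume_star_region_le => // u [/h].
  by rewrite /mu2 setIidl//; apply: integral_pow_ge => //; exact: ltW.
apply: sandwich => //.
- by move=> F mF tF FS; have [] := add F mF tF FS.
- move=> A b mA AS b0 h; rewrite /mu2 setIidl//; apply: integral_pow_le => // u Au.
  by rewrite h// r0//; exact: AS.
- by move=> A a mA AS a0 h; apply: volume_star_region_ge => // u [/h].
Qed.

End Sandwich.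

End PolarCoordinates.

(** * Positive continuous functions on the sphere *)

Section PositiveContinuous.
Context {R : realType} {n : nat}.
Implicit Types (f g : 'rV[R]_n -> R) (u : 'rV[R]_n).
Local Notation S := (sphere R n).

(** This class is closed under products and real powers of any sign, and its members are integrable;
    every integrand of the theorem belongs to it. *)
Definition pos_cont f := {within S, continuous f} /\ forall u, S u -> 0 < f u.

Lemma eq_pos_cont f g : (forall u, S u -> f u = g u) -> pos_cont f -> pos_cont g.
Proof.
move=> fg [cf f0]; split=> [|u Su]; last by rewrite -fg// f0.
by apply: subspace_eq_continuous cf => u /set_mem; exact: fg.
Qed.

Lemma pos_contM f g : pos_cont f -> pos_cont g -> pos_cont (fun u => f u * g u).
Proof.
move=> [cf f0] [cg g0]; split=> [u|u Su]; last by rewrite mulr_gt0 ?f0 ?g0.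
by apply: (@cvgM _ (subspace S)); [exact: cf|exact: cg].
Qed.

Lemma pos_cont1 : pos_cont (cst 1).
Proof. by split=> [u|u _] //; exact: cvg_cst. Qed.

Lemma pos_cont_prod (I : finType) (f : I -> 'rV[R]_n -> R) :
  (forall i, pos_cont (f i)) -> pos_cont (fun u => \prod_i f i u).
Proof.
move=> cf; elim: (index_enum I) => [|i s ih].
  by apply: eq_pos_cont pos_cont1 => u _; rewrite big_nil.
by apply: eq_pos_cont (pos_contM (cf i) ih) => u _; rewrite big_cons.
Qed.

Lemma powR_continuous (r a : R) : 0 < a -> {for a, continuous (fun x => x `^ r)}.
Proof.
move=> a0; have aI : a \in `]0, +oo[ by rewrite in_itv/= a0.
exact/differentiable_continuous/derivable1_diffP/(@derivable_powR R 1 r a aI).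
Qed.

Lemma pos_cont_powR f (r : R) : pos_cont f -> pos_cont (fun u => f u `^ r).
Proof.
move=> [/subspace_continuousP cf f0]; split=> [|u Su]; last by rewrite powR_gt0 ?f0.
apply/subspace_continuousP => u Su.
exact: (cvg_comp f (fun x => x `^ r) (cf u Su) (@powR_continuous r _ (f0 u Su))).
Qed.

Lemma pos_cont_measurable f : pos_cont f -> measurable_fun S f.
Proof.
move=> [cf _]; apply: within_continuous_measurable_rV => //.
exact: sphere_measurable.
Qed.

(** Compactness of the sphere bounds [f], and [sigma] is finite. *)
Lemma pos_cont_integrable f : pos_cont f -> (@sigma R n).-integrable S (EFin \o f).
Proof.
move=> cf; apply: measurable_bounded_integrable.
- exact: sphere_measurable.
- exact: (sigma_lty sphere_measurable).
- exact: pos_cont_measurable.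
have /compact_bounded[M [_ Mf]] := continuous_compact cf.1 sphere_compact.
by exists M; split; rewrite ?num_real// => N MN u Su /=; apply: (Mf _ MN); exists u.
Qed.

End PositiveContinuous.

(** * Integrals over the sphere; Hoelder's inequality and its reverse *)

Section SphericalIntegral.
Context {R : realType} {n : nat}.
Implicit Types (f g : 'rV[R]_n -> R) (u : 'rV[R]_n).
Local Notation S := (sphere R n).

Definition sphere_int f : R := (\int[sigma]_(u in S) f u)%R.

Lemma sphere_intE f : pos_cont f ->
  (\int[sigma]_(u in S) (f u)%:E = (sphere_int f)%:E)%E.
Proof.
move=> cf; rewrite /sphere_int /Rintegral fineK//.
by apply: integrable_fin_num (pos_cont_integrable cf); exact: sphere_measurable.
Qed.

Lemma eq_sphere_int f g : (forall u, S u -> f u = g u) -> sphere_int f = sphere_int g.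
Proof. by move=> fg; apply: eq_Rintegral => u /set_mem; exact: fg. Qed.

Lemma sphere_int_ge0 f : pos_cont f -> 0 <= sphere_int f.
Proof. by move=> [_ f0]; apply: Rintegral_ge0 => u /f0/ltW. Qed.

(* The premise forces [sigma S = 0]; treating this case spares a proof that
   [sigma S] is positive. *)
Lemma sphere_int_eq0 f g : pos_cont f -> pos_cont g ->
  sphere_int f = 0 -> sphere_int g = 0.
Proof.
move=> cf cg f0.
have mS : measurable S := sphere_measurable.
have S0 : sigma S = 0%E.
  have [->|/set0P S0] := eqVneq S set0; first by rewrite measure0.
  have [c /set_mem Sc minf] := EVT_min_rV S0 sphere_compact cf.1.
  have : ((f c)%:E * sigma S <= 0)%E.
    rewrite (_ : 0%E = (sphere_int f)%:E); last by rewrite f0.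
    rewrite -sphere_intE// -integral_cst//; apply: ge0_le_integral => //.
    - by move=> u _; rewrite lee_fin ltW// cf.2.
    - by apply/measurable_EFinP; exact: pos_cont_measurable.
    - by move=> u Su; rewrite lee_fin minf// inE.
  rewrite pmule_rle0 ?lte_fin ?cf.2// => S_le0.
  by apply/eqP; rewrite eq_le S_le0 measure_ge0.
rewrite /sphere_int /Rintegral null_set_integral//.
by apply/measurable_EFinP; exact: pos_cont_measurable.
Qed.

(** The exponential lies above its tangent at [z], the logarithm of the left-hand side. Taking this
    at [ln x] and [ln y] with weights [a] and [b], the linear terms cancel. *)
Lemma weighted_AMGM (a b x y : R) : 0 <= a -> 0 <= b -> a + b = 1 ->
  0 < x -> 0 < y -> x `^ a * y `^ b <= a * x + b * y.
Proof.
move=> a0 b0 ab x0 y0; pose z := a * ln x + b * ln y.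
have -> : x `^ a * y `^ b = expR z by rewrite /powR !gt_eqF// -expRD.
have le w : 0 < w -> expR z * (1 + (ln w - z)) <= w.
  move=> w0; rewrite [leRHS](_ : w = expR z * expR (ln w - z)).
    by rewrite ler_pM2l ?expR_gt0// expR_ge1Dx.
  by rewrite -expRD addrC subrK lnK.
have := lerD (ler_wpM2l a0 (le _ x0)) (ler_wpM2l b0 (le _ y0)).
apply: le_trans; rewrite le_eqVlt; apply/orP; left; apply/eqP.
rewrite /z; have -> : b = 1 - a by rewrite -ab addrAC subrr add0r.
by set e := expR _; ring.
Qed.

(** The weighted inequality of means is applied pointwise to [f] and [g] divided by their integrals,
    then integrated. *)
Lemma hoelder_sphere f g (a b : R) : pos_cont f -> pos_cont g ->
  0 <= a -> 0 <= b -> a + b = 1 ->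
  sphere_int (fun u => f u `^ a * g u `^ b) <= sphere_int f `^ a * sphere_int g `^ b.
Proof.
move=> cf cg a0 b0 ab.
have mS : measurable S := sphere_measurable.
have ch : pos_cont (fun u => f u `^ a * g u `^ b).
  by apply: pos_contM; exact: pos_cont_powR.
(* A vanishing integral could not be divided by; in that case the left-hand side vanishes as
   well. *)
have := sphere_int_ge0 cf; rewrite le_eqVlt => /predU1P[/esym X0|X0].
  by rewrite (sphere_int_eq0 cf ch X0) mulr_ge0 ?powR_ge0.
have := sphere_int_ge0 cg; rewrite le_eqVlt => /predU1P[/esym Y0|Y0].
  by rewrite (sphere_int_eq0 cg ch Y0) mulr_ge0 ?powR_ge0.
set X := sphere_int f in X0 *; set Y := sphere_int g in Y0 *.
set C := X `^ a * Y `^ b.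
have C0 : 0 < C by rewrite mulr_gt0 ?powR_gt0.
have iZ h (k : R) : pos_cont h -> (@sigma R n).-integrable S (EFin \o (fun u => k * h u)).
  by move=> chh; apply: (integrableZl mS _ (pos_cont_integrable chh)).
(* The integrand is [C] times the weighted arithmetic mean of [f / X] and [g / Y], which integrates
   to [C * (a + b)]. *)
have -> : C = sphere_int (fun u => (C * a / X) * f u + (C * b / Y) * g u).
  rewrite /sphere_int RintegralD//; [|exact: iZ..].
  rewrite !RintegralZl//; [|exact: pos_cont_integrable..].
  rewrite -/(sphere_int f) -/(sphere_int g) -/X -/Y.
  by rewrite !divfK ?gt_eqF// -mulrDr ab mulr1.
apply: le_Rintegral => //.
- exact: pos_cont_integrable.
- exact: (integrableD mS (iZ f _ cf) (iZ g _ cg)).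
move=> u Su; have fu := cf.2 u Su; have gu := cg.2 u Su.
have -> : f u `^ a * g u `^ b = C * ((f u / X) `^ a * (g u / Y) `^ b).
  rewrite /C mulrACA -!powRM ?divr_ge0 ?ltW//.
  by rewrite ![_ * (_ / _)]mulrC !divfK ?gt_eqF.
have := weighted_AMGM a0 b0 ab (divr_gt0 fu X0) (divr_gt0 gu Y0).
rewrite -(ler_pM2l C0) => /le_trans; apply.
by rewrite le_eqVlt; apply/orP; left; apply/eqP; ring.
Qed.

(** Here [a >= 1]. With [h = f]^ a * g [^ b], one has [f = h]^ a^-1 * g [^ (- b / a)], where the
    exponents are nonnegative with sum 1. Hoelder's inequality for [h] and [g], raised to the power
    [a], is the claim up to moving the power of the integral of [g] to the other side. *)
Lemma reverse_hoelder_sphere f g (a b : R) : pos_cont f -> pos_cont g ->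
  b <= 0 -> a + b = 1 ->
  sphere_int f `^ a * sphere_int g `^ b <= sphere_int (fun u => f u `^ a * g u `^ b).
Proof.
move=> cf cg b0 ab.
have a1 : 1 <= a by rewrite -ab gerDl.
have a0 : 0 < a by rewrite (lt_le_trans _ a1).
have ch : pos_cont (fun u => f u `^ a * g u `^ b).
  by apply: pos_contM; exact: pos_cont_powR.
have := sphere_int_ge0 cg; rewrite le_eqVlt => /predU1P[/esym Y0|Y0].
  by rewrite (sphere_int_eq0 cg cf Y0) powR0 ?gt_eqF// mul0r sphere_int_ge0.
have ab' : a^-1 + - b / a = 1.
  rewrite -[X in X + _]mul1r -mulrDl (_ : 1 + - b = a) ?mulfV ?gt_eqF//.
  by rewrite -ab addrK.
have a'0 : 0 <= a^-1 by rewrite invr_ge0 ltW.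
have b'0 : 0 <= - b / a by rewrite divr_ge0 ?oppr_ge0// ltW.
set Z := sphere_int (fun u => f u `^ a * g u `^ b).
have Z0 : 0 <= Z by exact: sphere_int_ge0.
have fZ : sphere_int f <= Z `^ a^-1 * sphere_int g `^ (- b / a).
  apply: le_trans (hoelder_sphere ch cg a'0 b'0 ab').
  rewrite le_eqVlt; apply/orP; left; apply/eqP.
  apply: eq_sphere_int => u Su; have fu := cf.2 u Su; have gu := cg.2 u Su.
  rewrite powRM ?powR_ge0// -!powRrM mulfV ?gt_eqF// powRr1 ?(ltW fu)//.
  rewrite -mulrA -powRD; last by rewrite (gt_eqF gu) implybT.
  by rewrite mulNr subrr powRr0 mulr1.
have XZ : sphere_int f `^ a <= (Z `^ a^-1 * sphere_int g `^ (- b / a)) `^ a.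
  apply: ge0_ler_powR fZ; rewrite ?nnegrE ?mulr_ge0 ?powR_ge0 ?(ltW a0)//.
  exact: sphere_int_ge0.
rewrite powRM ?powR_ge0// -!powRrM mulVf ?gt_eqF// powRr1// divfK ?gt_eqF// in XZ.
by rewrite powRN ler_pdivlMr ?powR_gt0// in XZ.
Qed.

End SphericalIntegral.

(** * Star bodies: volume, and construction from a radial function *)

Section StarBodies.
Context {R : realType} {n : nat}.
Implicit Types (L : set 'rV[R]_n) (r : 'rV[R]_n -> R) (u x : 'rV[R]_n).
Local Notation S := (sphere R n).

Lemma set1_0_measurable : measurable [set (0 : 'rV[R]_n)].
Proof.
rewrite (_ : [set 0] = @enorm R n @^-1` [set 0]).
  by apply: (measurable_preimageT enorm_measurable).
apply/seteqP; split => x /= /eqP x0; apply/eqP; first by rewrite enorm_eq0.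
by rewrite -enorm_eq0.
Qed.

(** The set is invariant under halving, while its volume, which is finite, would be multiplied by
    [2 ^+ n > 1]. *)
Lemma volume_set1_0 : (0 < n)%N -> volume [set (0 : 'rV[R]_n)%R] = 0%E.
Proof.
move=> n_gt0;pose Z : set 'rV[R]_n := [set 0].
have mZ : measurable Z := set1_0_measurable.
rewrite -/Z; have v_lty : (volume Z < +oo)%E.
  apply: le_lt_trans (volume_unit_ball_lty n); apply: le_measure; rewrite ?inE//.
    exact: unit_ball_measurable.
  move=> x ->; rewrite /unit_ball /=.
  by rewrite (eqP (_ : enorm 0 == 0)) ?enorm_eq0.
have half_gt0 : 0 < 2^-1 :> R by rewrite invr_gt0.
have := volume_scale half_gt0 mZ.
rewrite (_ : _ @^-1` _ = Z); last first.
  apply/seteqP; split => x /= => [/eqP|->]; last by rewrite scaler0.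
  by rewrite scaler_eq0 invr_eq0 pnatr_eq0/= => /eqP.
have [v ->] : exists v, volume Z = v%:E.
  by exists (fine (volume Z)); rewrite fineK// ge0_fin_numE.
move=> /eqP; rewrite invrK -EFinM eqe => /eqP v2; congr EFin; apply/eqP.
have k1 : 1 < 2 ^+ n :> R by rewrite exprn_egt1 ?ltr1n// -lt0n.
have : (2 ^+ n - 1) * v = 0 by rewrite mulrBl mul1r -v2 subrr.
by move/eqP; rewrite mulf_eq0 subr_eq0 gt_eqF.
Qed.

Lemma sphere_neq_set0 : (0 < n)%N -> S !=set0.
Proof.
move=> n_gt0; exists (normalize (const_mx 1)); rewrite sphere_normalize.
by apply/eqP => /rowP/(_ (Ordinal n_gt0))/eqP; rewrite !mxE oner_eq0.
Qed.

Lemma pos_cont_radial_fun L : star_body0 L -> pos_cont (radial_fun L).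
Proof. by case. Qed.

(** The origin is listed apart, being absent from [star_region]. It belongs to [L] because some
    direction exists when [n > 0], and a radial point can be scaled by 0. *)
Lemma star_body0E L : (0 < n)%N -> star_body0 L ->
  L = [set 0] `|` star_region (radial_fun L) setT.
Proof.
move=> n_gt0 [Lst Lrad Lpos _]; apply/seteqP; split => [x Lx|x [->|[[_ Sx] xr]]].
- have [->|x0] := eqVneq x 0; first by left.
  have Sx : S (normalize x) by rewrite sphere_normalize.
  right; split; first by [].
  apply: (ub_le_sup (Lrad _ Sx).1); split; first exact: enorm_ge0.
  by rewrite normalizeK.
- have [u Su] := sphere_neq_set0 n_gt0.
  rewrite -(scale0r (radial_fun L u *: u)); apply: Lst; last by rewrite lexx ler01.
  by have [_ []] := Lrad _ Su.
- have r0 := Lpos _ Sx.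
  rewrite -(normalizeK x) -(divfK (lt0r_neq0 r0) (enorm x)) -scalerA.
  apply: Lst; first by have [_ []] := Lrad _ Sx.
  by rewrite divr_ge0 ?enorm_ge0 ?(ltW r0)//= ler_pdivrMr ?mul1r.
Qed.

Lemma volume_star_body L : (0 < n)%N -> star_body0 L ->
  volume L = ((sphere_int (fun u => radial_fun L u `^ n%:R)) / n%:R)%:E.
Proof.
move=> n_gt0 Lst; have cr := pos_cont_radial_fun Lst.
(* The minimum of the radial function is the positive lower bound that [volume_polar] asks for. *)
have [c /set_mem Sc minf] := EVT_min_rV (sphere_neq_set0 n_gt0) sphere_compact cr.1.
have mr := pos_cont_measurable cr.
have n0 : n%:R != 0 :> R by rewrite pnatr_eq0 -lt0n.
have vE : volume L = volume (star_region (radial_fun L) setT).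
  have mreg : measurable (star_region (radial_fun L) setT).
    exact: star_region_measurable.
  rewrite {1}(star_body0E n_gt0 Lst) measureU//.
  - by rewrite -[RHS]add0e -(volume_set1_0 n_gt0).
  - exact: set1_0_measurable.
  - apply/seteqP; split => // x [->] [[_ +] _].
    by rewrite sphere_normalize eqxx.
have := volume_polar n_gt0 mr (cr.2 _ Sc) (fun u Su => minf u (mem_set Su)).
rewrite -vE (_ : integral _ _ _ =
  (sphere_int (fun u => radial_fun L u `^ n%:R))%:E); last first.
  rewrite -sphere_intE; last exact: pos_cont_powR.
  by apply: eq_integral => u /set_mem Su; rewrite powR_mulrn// ltW// cr.2.
set I := sphere_int _ => nv.
transitivity (n%:R^-1%:E * (n%:R%:E * volume L))%E.
  by rewrite muleA -EFinM mulVf// mul1e.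
by rewrite nv -EFinM mulrC.
Qed.

(** The origin has its own clause, since [r] is controlled on the sphere only and [normalize 0] is
    0. *)
Definition radial_body r : set 'rV[R]_n :=
  [set x | x = 0 \/ enorm x <= r (normalize x)].

Lemma radii_radial_body r u : pos_cont r -> S u ->
  radii (radial_body r) u = `[0, r u]%classic.
Proof.
move=> cr Su; have r0 := cr.2 u Su; have u0 := sphere_neq0 Su.
apply/seteqP; split => l /=; rewrite in_itv/= /radii /radial_body /=.
  move=> [l0]; rewrite l0 /=; have [->|l_neq0] := eqVneq l 0.
    by move=> _; exact: ltW.
  have lgt0 : 0 < l by rewrite lt_def l_neq0.
  case=> [/eqP|]; first by rewrite scaler_eq0 (negbTE l_neq0) (negbTE u0).
  by rewrite normalizeZ// normalize_sphere// enormZ Su mulr1 ger0_norm.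
move=> /andP[l0 lr]; split=> //; have [->|l_neq0] := eqVneq l 0.
  by left; rewrite scale0r.
have lgt0 : 0 < l by rewrite lt_def l_neq0.
by right; rewrite normalizeZ// normalize_sphere// enormZ Su mulr1 ger0_norm.
Qed.

Lemma radial_fun_radial_body r u : pos_cont r -> S u ->
  radial_fun (radial_body r) u = r u.
Proof.
move=> cr Su; rewrite /radial_fun radii_radial_body// sup_itvcc// ltW//.
exact: cr.2.
Qed.

Lemma star_body0_radial_body r : pos_cont r -> star_body0 (radial_body r).
Proof.
move=> cr; have [cf f0] : pos_cont (radial_fun (radial_body r)).
  by apply: (eq_pos_cont _ cr) => u Su; rewrite radial_fun_radial_body.
split=> // [x t Lx /andP[t0 t1]|u Su]; last first.
  rewrite radial_fun_radial_body// radii_radial_body//; split.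
    exists (r u); apply/ubP => l /=; rewrite in_itv/= => /andP[_]; exact.
  by rewrite /= in_itv/= lexx andbT ltW// cr.2.
have [->|t_neq0] := eqVneq t 0; first by left; rewrite scale0r.
case: Lx => [->|xr]; first by left; rewrite scaler0.
right; rewrite normalizeZ ?lt_def ?t_neq0// enormZ ger0_norm//.
by apply: le_trans xr; rewrite ler_piMl ?enorm_ge0.
Qed.

End StarBodies.

(** * Support functions and curvature functions are positive and continuous *)

Section SupportFunction.
Context {R : realType} {n : nat}.
Implicit Types (K : set 'rV[R]_n) (u x : 'rV[R]_n).
Local Notation S := (sphere R n).

Let coord_dist (u v : 'rV[R]_n) : R := \sum_(i < n) `|u 0 i - v 0 i|.

Let compact_coord K : compact K ->
  exists2 M : R, 0 <= M & forall x, K x -> forall i, `|x 0 i| <= M.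
Proof.
move=> /compact_bounded[M [_ KM]]; exists (`|M| + 1) => // x Kx i.
have := KM (`|M| + 1) _ x Kx; rewrite ltr_pwDr ?ler_norm// => /(_ isT).
apply: le_trans; rewrite [leRHS](mx_normrE x).
by apply: (@le_bigmax _ _ _ 0 (fun ij : 'I_1 * 'I_n => `|x ij.1 ij.2|) (0, i)).
Qed.

Let dot_le (M : R) x u v : (forall i, `|x 0 i| <= M) ->
  dot x u <= dot x v + M * coord_dist u v.
Proof.
move=> xM; rewrite -lerBlDl -dotBr /dot /coord_dist mulr_sumr.
apply: ler_sum => i _; rewrite (le_trans (ler_norm _))// normrM.
by rewrite !mxE ler_wpM2r.
Qed.

Let has_ubound_dot K u : compact K -> has_ubound [set dot x u | x in K].
Proof.
move=> /compact_coord[M M0 KM]; exists (M * coord_dist u 0) => _ [x Kx <-].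
apply: (le_trans (dot_le u 0 (KM x Kx))).
by rewrite {1}/dot big1 ?add0r// => i _; rewrite mxE mulr0.
Qed.

(** If [M] bounds the coordinates of the points of [K], each [dot x] with [x] in [K] is
    [M]-Lipschitz for the distance [coord_dist], hence so is their supremum. *)
Lemma support_fun_continuous K : compact K -> K !=set0 ->
  continuous (support_fun K).
Proof.
move=> cK [x0 Kx0] u; have [M M0 KM] := compact_coord cK.
have h_le v w : support_fun K v <= support_fun K w + M * coord_dist v w.
  apply: ge_sup; first by exists (dot x0 v), x0.
  move=> _ [x Kx <-]; apply: (le_trans (dot_le v w (KM x Kx))).
  rewrite lerD2r; apply: ub_le_sup; first exact: has_ubound_dot.
  by exists x.
have cd : M * coord_dist v u @[v --> u] --> (0 : R).
  rewrite [X in _ --> X](_ : 0 = M * coord_dist u u); last first.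
    by rewrite /coord_dist big1 ?mulr0// => i _; rewrite subrr normr0.
  have cs : continuous (coord_dist^~ u).
    apply: continuous_big => [|i _ w]; first exact: add_continuous.
    apply: (@continuous_comp _ _ _ (fun v : 'rV[R]_n => v 0 i - u 0 i) (fun y : R => `|y|)).
      apply: (continuousB (f := fun v : 'rV[R]_n => v 0 i : R) (g := cst (u 0 i))).
        exact: (@coord_continuous _ 1 n 0 i).
      by apply: cst_continuous.
    exact: norm_continuous.
  exact: cvgMl_tmp (cs u).
have near_h : \forall v \near u, support_fun K u - M * coord_dist v u <=
    support_fun K v <= support_fun K u + M * coord_dist v u.
  apply: (@filterE _ (nbhs u)) => v; rewrite h_le andbT lerBlDr.
  rewrite (_ : coord_dist v u = coord_dist u v) ?h_le//.
  by apply: eq_bigr => i _; rewrite distrC.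
apply: (squeeze_cvgr near_h).
  by rewrite -[X in _ --> X]subr0; exact: (cvgB (cvg_cst _) cd).
by rewrite -[X in _ --> X]addr0; exact: (cvgD (cvg_cst _) cd).
Qed.

Lemma pos_cont_support_fun K : convex_body0 K -> pos_cont (support_fun K).
Proof.
move=> [_ cK K0]; split.
  apply: continuous_subspaceT; apply: support_fun_continuous => //.
  by exists 0; exact: interior_subset K0.
move=> u Su; have /nbhs_ballP[e /= e0 eK] := K0.
(* The coordinates of [u] are at most 1 in absolute value, so this point lies in the sup-norm ball
   of radius [e]. Its product with [u] is [e / 2], which bounds the support function from below. *)
have Ku : K ((e / 2) *: u).
  apply: eK; split => // i j; rewrite /ball /= !mxE sub0r normrN normrM.
  rewrite gtr0_norm ?divr_gt0// (ord1 i).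
  rewrite (@le_lt_trans _ _ (e / 2))// ?gtr_pMr ?invf_lt1 ?ltr1n//.
  by rewrite ler_piMr ?divr_ge0 ?(ltW e0)// -Su coord_le_enorm.
apply: (@lt_le_trans _ _ (dot ((e / 2) *: u) u)).
  by rewrite dotZl -[dot u u]sqr_sqrtr ?dot_ge0// -/(enorm u) Su expr1n mulr1 divr_gt0.
apply: ub_le_sup; first exact: has_ubound_dot.
by exists ((e / 2) *: u).
Qed.

Lemma pos_cont_p_curvature_fun p K : has_pos_cont_curvature_fun K ->
  pos_cont (p_curvature_fun p K).
Proof.
move=> [[K0 _] cf f0]; apply: pos_contM; last by split.
exact/pos_cont_powR/pos_cont_support_fun.
Qed.

End SupportFunction.

Lemma prod_powR (R : realType) (I : finType) (x : I -> R) (r : R) :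
  (forall i, 0 <= x i) -> \prod_i x i `^ r = (\prod_i x i) `^ r.
Proof.
(* Nonnegativity joins the induction because [powRM] asks for it. *)
move=> x0; suff [] : 0 <= \prod_i x i /\ \prod_i x i `^ r = (\prod_i x i) `^ r by [].
elim: (index_enum I) => [|i s [s0 sE]]; first by rewrite !big_nil powR1.
by rewrite !big_cons mulr_ge0// sE powRM.
Qed.

(** * The functional in terms of the geometric mean, and its extremal body *)

Section Extremal.
Context {R : realType} {n : nat}.
Variables (n_gt0 : (0 < n)%N) (p : R) (np0 : n%:R + p != 0).
Variables (K : 'I_n -> set 'rV[R]_n).
Hypothesis K_F0plus : forall i, has_pos_cont_curvature_fun (K i).
Local Notation S := (sphere R n).

Definition geometric_mean u : R := \prod_(i < n) p_curvature_fun p (K i) u `^ n%:R^-1.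

Local Notation g := geometric_mean.
Local Notation a := (n%:R / (n%:R + p)).
Local Notation b := (p / (n%:R + p)).

Let n0 : n%:R != 0 :> R. Proof. by rewrite pnatr_eq0 -lt0n. Qed.

Lemma exponents_sum : a + b = 1.
Proof. by rewrite -mulrDl mulfV. Qed.

Lemma pos_cont_geometric_mean : pos_cont g.
Proof. by apply: pos_cont_prod => i; exact/pos_cont_powR/pos_cont_p_curvature_fun. Qed.

Let curv_ge0 i u : S u -> 0 <= p_curvature_fun p (K i) u.
Proof. by move=> Su; rewrite ltW// (pos_cont_p_curvature_fun p (K_F0plus i)).2. Qed.

Lemma mixed_affine_surface_areaE :
  mixed_affine_surface_area p K = (sphere_int (fun u => g u `^ a))%:E.
Proof.
rewrite -sphere_intE; last exact/pos_cont_powR/pos_cont_geometric_mean.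
apply: eq_integral => u /set_mem Su; congr EFin.
rewrite /geometric_mean -prod_powR; last by move=> i; exact: powR_ge0.
by apply: eq_bigr => i _; rewrite -powRrM mulrA mulVf// mul1r.
Qed.

Let weighted (r : 'rV[R]_n -> R) u : R := r u `^ (- p) * g u.

Let pos_cont_weighted r : pos_cont r -> pos_cont (weighted r).
Proof.
move=> cr; apply: pos_contM; last exact: pos_cont_geometric_mean.
exact: pos_cont_powR.
Qed.

Lemma mixed_p_volume_polarE L : star_body0 L ->
  mixed_p_volume_polar p K L =
  (n%:R^-1 * sphere_int (fun u => radial_fun L u `^ (- p) * g u))%:E.
Proof.
move=> Lst; have cr := pos_cont_radial_fun Lst.
rewrite EFinM -sphere_intE; last exact: pos_cont_weighted.
congr (_ * _)%E; apply: eq_integral => u /set_mem Su; congr EFin.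
under eq_bigr do rewrite powRM ?powR_ge0 ?curv_ge0//.
rewrite big_split/= prodr_const card_ord -powR_mulrn ?powR_ge0//.
by rewrite -powRrM mulVf// powRr1 ?powR_ge0.
Qed.

Lemma functionalE L : star_body0 L ->
  (n%:R%:E * mixed_p_volume_polar p K L `^ a * volume L `^ b =
   (sphere_int (fun u => radial_fun L u `^ (- p) * g u) `^ a
    * sphere_int (fun u => radial_fun L u `^ n%:R) `^ b)%:E)%E.
Proof.
move=> Lst; have cr := pos_cont_radial_fun Lst.
rewrite mixed_p_volume_polarE// volume_star_body// !poweR_EFin -!EFinM; congr EFin.
set F := sphere_int _; set G := sphere_int _.
have F0 : 0 <= F by exact/sphere_int_ge0/pos_cont_weighted.
have G0 : 0 <= G by exact/sphere_int_ge0/pos_cont_powR.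
have i0 : 0 <= n%:R^-1 :> R by rewrite invr_ge0.
rewrite powRM// powRM//.
have nE : n%:R * (n%:R^-1 `^ a * n%:R^-1 `^ b) = 1 :> R.
  by rewrite -powRD exponents_sum ?oner_eq0// powRr1// mulfV.
have regroup (k x y z w : R) : k * (x * y) = 1 -> k * (x * z) * (w * y) = z * w.
  by move=> e; rewrite -[RHS]mul1r -e; ring.
exact: regroup nE.
Qed.

Lemma integrand_factorization r u : pos_cont r -> S u ->
  (r u `^ (- p) * g u) `^ a * (r u `^ n%:R) `^ b = g u `^ a.
Proof.
move=> cr Su; have ru := cr.2 u Su.
have gu := pos_cont_geometric_mean.2 u Su.
rewrite powRM ?powR_ge0// ?(ltW gu)// mulrAC -!powRrM -powRD; last first.
  by rewrite (gt_eqF ru) implybT.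
by rewrite (_ : - p * a + n%:R * b = 0) ?powRr0 ?mul1r//; field.
Qed.

Let optimal u : R := g u `^ (n%:R + p)^-1.

Lemma extremal_body : exists2 L, star_body0 L &
  (n%:R%:E * mixed_p_volume_polar p K L `^ a * volume L `^ b =
   mixed_affine_surface_area p K)%E.
Proof.
have cg := pos_cont_geometric_mean.
have co : pos_cont optimal by exact: pos_cont_powR.
exists (radial_body optimal); first exact: star_body0_radial_body.
rewrite functionalE; last exact: star_body0_radial_body.
rewrite mixed_affine_surface_areaE; congr EFin; set H := sphere_int (fun u => g u `^ a).
have H0 : 0 <= H by exact/sphere_int_ge0/pos_cont_powR.
rewrite (_ : sphere_int (fun u => _ * g u) = H); last first.
  apply: eq_sphere_int => u Su; rewrite radial_fun_radial_body//.
  have gu := cg.2 u Su; rewrite -powRrM -[X in _ * X]powRr1 ?(ltW gu)// -powRD.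
    by congr powR; field.
  by rewrite (gt_eqF gu) implybT.
rewrite (_ : sphere_int (fun u => _ `^ _) = H); last first.
  apply: eq_sphere_int => u Su; rewrite radial_fun_radial_body//.
  by rewrite -powRrM mulrC.
(* The exponents add up to 1, not 0, so the two powers merge even if [H] is 0. *)
by rewrite -powRD exponents_sum ?oner_eq0// powRr1.
Qed.

End Extremal.

Theorem theorem3p1 (R : realType) (n : nat) (n_gt0 : (0 < n)%N)
    (K : 'I_n -> set 'rV[R]_n)
    (K_F0plus : forall i, has_pos_cont_curvature_fun (K i)) (p : R) :
  (0 <= p ->
     mixed_affine_surface_area p K =
     ereal_inf [set (n%:R%:E * mixed_p_volume_polar p K L `^ (n%:R / (n%:R + p))
                             * volume L `^ (p / (n%:R + p)))%E
               | L in [set L | star_body0 L]])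
  /\
  (p < 0 -> p != - n%:R ->
     mixed_affine_surface_area p K =
     ereal_sup [set (n%:R%:E * mixed_p_volume_polar p K L `^ (n%:R / (n%:R + p))
                             * volume L `^ (p / (n%:R + p)))%E
               | L in [set L | star_body0 L]]).
Proof.
have n0 : 0 < n%:R :> R by rewrite ltr0n.
split=> [p0|p0 pn].
- have np0 : 0 < n%:R + p by rewrite ltr_wpDr.
  have npn0 : n%:R + p != 0 by rewrite gt_eqF.
  apply/eqP; rewrite eq_le; apply/andP; split.
    apply/ereal_infP => _ [L /= Lst <-]; rewrite functionalE//.
    rewrite mixed_affine_surface_areaE// lee_fin.
    have cr := pos_cont_radial_fun Lst.
    have cg := pos_cont_geometric_mean p K_F0plus.
    rewrite (_ : sphere_int _ = sphere_int (fun u =>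
        (radial_fun L u `^ (- p) * geometric_mean p K u) `^ (n%:R / (n%:R + p)) *
        (radial_fun L u `^ n%:R) `^ (p / (n%:R + p)))); last first.
      by apply: eq_sphere_int => u Su; rewrite integrand_factorization.
    apply: hoelder_sphere.
    + by apply: pos_contM => //; exact: pos_cont_powR.
    + exact: pos_cont_powR.
    + by rewrite divr_ge0// ltW.
    + by rewrite divr_ge0// ltW.
    + exact: exponents_sum.
  have [L Lst <-] := extremal_body n_gt0 npn0 K_F0plus.
  by apply: ge_ereal_inf; exists (n%:R%:E * mixed_p_volume_polar p K L `^ (n%:R / (n%:R + p))
                             * volume L `^ (p / (n%:R + p)))%E => //; exists L.
- have npn0 : n%:R + p != 0 by rewrite addrC addr_eq0.
  apply/eqP; rewrite eq_le; apply/andP; split.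
    have [L Lst <-] := extremal_body n_gt0 npn0 K_F0plus.
    by apply: ereal_sup_ubound; exists L.
  apply/ereal_supP => _ [L /= Lst <-]; rewrite functionalE//.
  rewrite mixed_affine_surface_areaE// lee_fin.
  have cr := pos_cont_radial_fun Lst.
  have cg := pos_cont_geometric_mean p K_F0plus.
  rewrite [leRHS](_ : _ = sphere_int (fun u =>
        (radial_fun L u `^ (- p) * geometric_mean p K u) `^ (n%:R / (n%:R + p)) *
        (radial_fun L u `^ n%:R) `^ (p / (n%:R + p)))); last first.
    by apply: eq_sphere_int => u Su; rewrite integrand_factorization.
  have cF : pos_cont (fun u => radial_fun L u `^ (- p) * geometric_mean p K u).
    by apply: pos_contM => //; exact: pos_cont_powR.
  have cG := pos_cont_powR n%:R cr.
  have ab := exponents_sum npn0.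
  (* As [p < 0], the exponent that may be negative is [b] if [n + p > 0], and [a] otherwise; in the
     second case the reverse inequality is used with the two functions exchanged. *)
  have [np0|np0] := ltP 0 (n%:R + p).
    apply: reverse_hoelder_sphere => //.
    by rewrite pmulr_lle0 ?invr_gt0// ltW.
  have ba : p / (n%:R + p) + n%:R / (n%:R + p) = 1 by rewrite addrC.
  have a0 : n%:R / (n%:R + p) <= 0 by rewrite pmulr_rle0// invr_le0.
  rewrite mulrC; apply: le_trans (reverse_hoelder_sphere cG cF a0 ba) _.
  by rewrite le_eqVlt; apply/orP; left; apply/eqP/eq_sphere_int => u _; rewrite mulrC.
Qed.
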